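(* Let $A$ be a hemiimplicative semilattice and $a,b\in A$. Then, for all $x,y\in A$, $(x,y)\in\theta(a,b)$ if and only if $x\leftrightarrow y\in T(\{a\leftrightarrow b\})$.
   Context: A hemiimplicative semilattice is an algebra $(A,\wedge,\to,1)$ of type $(2,2,0)$ such that: $(A,\wedge,1)$ is a meet-semilattice with greatest element $1$ (ordered by $a\le b$ iff $a\wedge b=a$); $a\to a=1$ for every $a\in A$; and for all $a,b,c\in A$, if $a\le b\to c$ then $a\wedge b\le c$. Write $a\leftrightarrow b:=(a\to b)\wedge(b\to a)$ and $t(a,b,f):=(a\to b)\leftrightarrow((a\wedge f)\to(b\wedge f))$. $\theta(a,b)$ denotes the congruence of $A$ generated by the pair $(a,b)$. For $X\subseteq A$ and $x,y\in A$, $t^{+}(x,y,X)$ is the set of all $z\in A$ such that $z\ge t(x,y,w_1)\wedge\dots\wedge t(x,y,w_k)\wedge w_{k+1}\wedge\dots\wedge w_{k+l}$ for some $k,l\geq 0$ and some $w_1,\dots,w_{k+l}\in X$ with $k+l\ge 1$. Put $t(X):=\bigcup_{x,y\in A}t^{+}(x,y,X)$, $T_0(X):=X$, $T_{n+1}(X):=t(T_n(X))$, and $T(X):=\bigcup_{n\in\mathbb{N}}T_n(X)$, where $\mathbb N$ includes $0$. *)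

(* Defs.v *)
From HB Require Import structures.
From mathcomp Require Import all_boot all_order.
From mathcomp Require Import classical_sets.

Set Implicit Arguments.
Unset Strict Implicit.
Unset Printing Implicit Defensive.

Import Order.TTheory.

Local Open Scope order_scope.

(* In a [tMeetSemilatticeType], [x <= y] is [x `&` y == x] (lemma [leEmeet]) and
   the greatest element [1] of the algebra is [\top]. *)
HB.mixin Record isHemiimplicative (d : Order.disp_t) T
    of Order.TMeetSemilattice d T := {
  himp : T -> T -> T;
  himpxx : forall a : T, himp a a = \top;
  le_himp : forall a b c : T, a <= himp b c -> a `&` b <= c
}.

#[short(type="hemiimplicativeSemilatticeType")]
HB.structure Definition HemiimplicativeSemilattice (d : Order.disp_t) :=
  { T of Order.TMeetSemilattice d T & isHemiimplicative d T }.

Notation "x `=>` y" := (himp x y)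
  (at level 55, right associativity) : order_scope.

Section Defs.
Context {d : Order.disp_t} {A : hemiimplicativeSemilatticeType d}.
Implicit Types (a b f x y z : A) (X : set A) (R : set (A * A)).

Definition heqv a b : A := (a `=>` b) `&` (b `=>` a).

Definition tterm a b f : A := heqv (a `=>` b) ((a `&` f) `=>` (b `&` f)).

(* Compatibility with the constant [\top] is an instance of reflexivity. *)
Record congruence R : Prop := Congruence {
  congr_refl : forall x, R (x, x);
  congr_sym : forall x y, R (x, y) -> R (y, x);
  congr_trans : forall x y z, R (x, y) -> R (y, z) -> R (x, z);
  congr_meet : forall x x' y y',
    R (x, x') -> R (y, y') -> R (x `&` y, x' `&` y');
  congr_himp : forall x x' y y',
    R (x, x') -> R (y, y') -> R (x `=>` y, x' `=>` y')
}.

Definition theta a b : set (A * A) := smallest congruence [set (a, b)]%classic.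

(* The family [w_1, ..., w_(k+l)] is indexed by ['I_(k + l)]; an empty
   [\meet] is [\top], so [k = 0] or [l = 0] just drops that block. *)
Definition tplus x y X : set A :=
  [set z : A | exists (k l : nat) (w : 'I_(k + l) -> A),
    [/\ (1 <= k + l)%N,
        forall i, X (w i) &
        ((\meet_(i < k) tterm x y (w (lshift l i))) `&`
          (\meet_(j < l) w (rshift k j)) <= z)%O]]%classic.

Definition tset X : set A :=
  (\bigcup_(xy in [set: A * A]) tplus xy.1 xy.2 X)%classic.

Definition Titer (n : nat) X : set A := iter n tset X.

Definition Tset X : set A := (\bigcup_(n in [set: nat]) Titer n X)%classic.

End Defs.

Notation "x `<->` y" := (heqv x y)
  (at level 55, right associativity) : order_scope.

(* Main.v *)
Require Import Defs.
From HB Require Import structures.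
From mathcomp Require Import all_boot all_order.
From mathcomp Require Import classical_sets.

(** Both sides are compared through filters. A congruence is determined by the
    class of [\top], since [x] and [y] are congruent iff [x `<->` y] is congruent
    to [\top]; this class is a filter closed under [f |-> tterm x y f]. Conversely,
    every filter [F] closed in this way yields the congruence "[x] and [y] have
    the same meet with some [f] in [F]". Finally [Tset X] is the smallest such
    filter containing a nonempty set [X]. *)

Set Implicit Arguments.
Unset Strict Implicit.

Import Order.TTheory.

Local Open Scope order_scope.

Section HemiimplicativeTheory.
Context {d : Order.disp_t} {A : hemiimplicativeSemilatticeType d}.
Implicit Types (a b f u v x y z : A) (X F : set A) (R : set (A * A)).

Lemma heqvC x y : x `<->` y = y `<->` x.
Proof. exact: meetC. Qed.

Lemma heqvxx x : x `<->` x = \top.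
Proof. by rewrite /heqv himpxx meetxx. Qed.

Lemma meet_heqv_le x y : x `&` (x `<->` y) <= y.
Proof. by rewrite meetC; apply: le_himp; exact: leIl. Qed.

Lemma meet_heqv x y : x `&` (x `<->` y) = y `&` (x `<->` y).
Proof.
have le u v : u `&` (u `<->` v) <= v `&` (u `<->` v).
  by rewrite lexI meet_heqv_le leIr.
by apply: le_anti; rewrite le heqvC le.
Qed.

Lemma heqv_top_le x : x `<->` \top <= x.
Proof.
have := meet_heqv_le \top x.
by rewrite meet1x heqvC.
Qed.

(** Replacing [x] by [y] turns [heqv x y] into [heqv y y], which is [\top]. Conversely, when
    [heqv x y] is congruent to [\top], meeting with it moves neither [x] nor [y] out of its class,
    and [meet_heqv] makes the two meets equal. *)
Lemma congr_heqv_top R x y :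
  congruence R -> R (x, y) <-> R (x `<->` y, \top).
Proof.
move=> cR; split=> [Rxy | Rxy1].
  rewrite -(heqvxx y); apply: congr_meet => //.
    by apply: congr_himp => //; exact: congr_refl.
  by apply: congr_himp => //; exact: congr_refl.
have absorb z : R (z `&` (x `<->` y), z).
  rewrite -[X in R (_, X)]meetx1.
  by apply: congr_meet => //; exact: congr_refl.
apply: (congr_trans cR (congr_sym cR (absorb x))).
by rewrite meet_heqv; exact: absorb.
Qed.

Lemma congr_top_meet R x y :
  congruence R -> R (x, \top) -> R (y, \top) -> R (x `&` y, \top).
Proof. by move=> cR Rx Ry; rewrite -(meetxx \top); apply: congr_meet. Qed.

Lemma congr_top_le R x y :
  congruence R -> x <= y -> R (x, \top) -> R (y, \top).
Proof.
move=> cR /meet_idPr yx Rx; suff Ryx : R (y, x) by exact: congr_trans Rx.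
rewrite -[y]meetx1 -yx.
by apply: congr_meet => //; [exact: congr_refl|exact: congr_sym].
Qed.

(** Every element is congruent to its meet with [f], so the two implications inside [tterm x y f]
    are congruent. *)
Lemma congr_top_tterm R x y f :
  congruence R -> R (f, \top) -> R (tterm x y f, \top).
Proof.
move=> cR Rf; apply: (iffLR (congr_heqv_top _ _ cR)).
have absorb z : R (z, z `&` f).
  rewrite -{1}[z]meetx1.
  by apply: congr_meet => //; [exact: congr_refl|exact: congr_sym].
exact: (congr_himp cR (absorb x) (absorb y)).
Qed.

Lemma congr_top_bigmeet R n (w : 'I_n -> A) :
  congruence R -> (forall i, R (w i, \top)) -> R (\meet_(i < n) w i, \top).
Proof.
move=> cR Rw; apply: (big_ind (fun z => R (z, \top))) => //.
  exact: congr_refl.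
by move=> u v; exact: congr_top_meet.
Qed.

(** Induction on the stage [n]: the class of [\top] is closed under everything that [tplus] is built
    from. *)
Lemma congr_top_Tset R X :
  congruence R -> (forall x, X x -> R (x, \top)) ->
  forall z, Tset X z -> R (z, \top).
Proof.
move=> cR RX z [n _]; elim: n z => [|n IHn] z; first exact: RX.
move=> [[x y] _ [k [l [w [_ Tw wz]]]]].
apply: (congr_top_le cR wz); apply: congr_top_meet => //.
  apply: congr_top_bigmeet => // i; apply: congr_top_tterm => //.
  by apply: IHn; exact: Tw.
apply: congr_top_bigmeet => // i.
by apply: IHn; exact: Tw.
Qed.

Record tfilter F : Prop := Tfilter {
  tfilter_nonempty : exists f, F f;
  tfilter_le : forall x y, x <= y -> F x -> F y;
  tfilter_meet : forall x y, F x -> F y -> F (x `&` y);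
  tfilter_tterm : forall x y f, F f -> F (tterm x y f)
}.

Definition filter_rel F : set (A * A) :=
  [set xy | exists2 f, F f & (xy.1 `&` f = xy.2 `&` f)%O]%classic.

Lemma filter_rel_heqv F x y : tfilter F -> filter_rel F (x, y) <-> F (x `<->` y).
Proof.
move=> tF; split=> [[f Ff /= xfyf]|Fxy]; last first.
  by exists (x `<->` y) => //=; exact: meet_heqv.
(* When [u `&` f = v `&` f], [tterm u v f] is [(u `=>` v) `<->` \top]. *)
have Fhimp u v : u `&` f = v `&` f -> F (u `=>` v).
  move=> ufvf; apply: tfilter_le (tfilter_tterm tF u v Ff) => //.
  by rewrite /tterm ufvf himpxx; exact: heqv_top_le.
by apply: tfilter_meet => //; apply: Fhimp.
Qed.

Lemma filter_rel_trans F x y z :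
  tfilter F -> filter_rel F (x, y) -> filter_rel F (y, z) -> filter_rel F (x, z).
Proof.
move=> tF [f Ff /= xy] [g Fg /= yz].
exists (f `&` g) => /=; first exact: tfilter_meet.
by rewrite meetA xy meetAC yz meetAC meetA.
Qed.

Lemma filter_rel_sym F x y : filter_rel F (x, y) -> filter_rel F (y, x).
Proof. by move=> [f Ff xy]; exists f. Qed.

Lemma filter_rel_congruence F : tfilter F -> congruence (filter_rel F).
Proof.
move=> tF; split.
- by move=> x; have [f Ff] := tfilter_nonempty tF; exists f.
- by move=> x y; exact: filter_rel_sym.
- by move=> x y z; exact: filter_rel_trans.
- move=> x x' y y' [f Ff /= xx'] [g Fg /= yy'].
  exists (f `&` g) => /=; first exact: tfilter_meet.
  by rewrite !(meetACA _ _ f g) xx' yy'.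
- move=> x x' y y' [f Ff /= xx'] [g Fg /= yy'].
  have Fh : F (f `&` g) by exact: tfilter_meet.
  have hxx' : x `&` (f `&` g) = x' `&` (f `&` g) by rewrite !meetA xx'.
  have hyy' : y `&` (f `&` g) = y' `&` (f `&` g).
    by rewrite !(meetCA _ f g) yy'.
  (* This is where closure under [tterm] enters. Meeting with [f] and [g] identifies [x] with [x']
     and [y] with [y'], so the restricted implication links the two unrestricted ones. *)
  have restrict u v :
      filter_rel F (u `=>` v, (u `&` (f `&` g)) `=>` (v `&` (f `&` g))).
    by apply/filter_rel_heqv => //; exact: tfilter_tterm.
  apply: (filter_rel_trans tF (restrict x y)).
  by rewrite hxx' hyy'; apply: filter_rel_sym; exact: restrict.
Qed.

Lemma tset_meet_le X x y z : X x -> X y -> x `&` y <= z -> tset X z.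
Proof.
move=> Xx Xy xyz; exists (z, z) => //=.
(* With [k = 0] no [tterm] occurs, so the choice of the pair [(z, z)] is arbitrary. *)
exists 0%N, 2%N, (fun i : 'I_2 => if i == ord0 then x else y); split=> //.
  by move=> i; case: ifP.
by rewrite big_ord0 meet1x !big_ord_recl big_ord0 meetx1.
Qed.

Lemma tset_tterm X x y f : X f -> tset X (tterm x y f).
Proof.
move=> Xf; exists (x, y) => //=.
exists 1%N, 0%N, (fun=> f); split=> //.
by rewrite big_ord0 meetx1 big_ord1.
Qed.

Lemma Titer_homo X m n z : (m <= n)%N -> Titer m X z -> Titer n X z.
Proof.
move=> /subnK <-; elim: (n - m)%N => // k IHk /IHk Tz.
by rewrite addSn; apply: (tset_meet_le Tz Tz); exact: leIl.
Qed.

(** Upward closure, meets and [tterm] each cost one more application of [tset]; for meets, both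
    elements are first brought to a common stage. *)
Lemma Tset_tfilter X x : X x -> tfilter (Tset X).
Proof.
move=> Xx; split.
- by exists x, 0%N.
- move=> y z yz [n _ Ty]; exists n.+1 => //.
  by apply: (tset_meet_le Ty Ty); rewrite meetxx.
- move=> y z [m _ Ty] [n _ Tz]; exists (maxn m n).+1 => //.
  have Ty' := Titer_homo (leq_maxl m n) Ty.
  have Tz' := Titer_homo (leq_maxr m n) Tz.
  exact: (tset_meet_le Ty' Tz').
- by move=> y z f [n _ Tf]; exists n.+1 => //; exact: tset_tterm.
Qed.

End HemiimplicativeTheory.

Theorem corollary4p13 (d : Order.disp_t) (A : hemiimplicativeSemilatticeType d)
    (a b : A) :
  forall x y : A, theta a b (x, y) <-> Tset [set a `<->` b]%classic (x `<->` y).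
Proof.
move=> x y.
have Tab : Tset [set a `<->` b]%classic (a `<->` b) by exists 0%N.
have tF : tfilter (Tset [set a `<->` b]%classic).
  exact: (@Tset_tfilter _ _ _ (a `<->` b)).
split=> [thxy | Txy R [cR Rab]].
  (* Minimality of [theta] is applied to the congruence induced by the filter. *)
  apply/filter_rel_heqv => //; apply: thxy; split.
    exact: filter_rel_congruence.
  by move=> _ ->; apply/filter_rel_heqv.
(* The class of [\top] under [R] contains the generator [heqv a b], hence all of [Tset]. *)
apply/(congr_heqv_top _ _ cR); apply: congr_top_Tset Txy => // _ ->.
by apply: (iffLR (congr_heqv_top _ _ cR)); exact: Rab.
Qed.
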